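(* There exists a family of 3-SAT formulas $(F_N)_N$, where $F_N$ has $O(N^2/\log N)$ variables, such that \[ \beta_2(S(F_N))=2^{\Omega(N)}. \]
   Context: For a CNF formula $F$ on $n$ variables, the solution complex $S(F)$ is the cubical subcomplex of $\{0,1\}^n$ whose vertices are satisfying assignments and whose $k$-faces are axis-aligned $k$-dimensional subcubes all of whose $2^k$ vertices satisfy $F$. $\beta_2$ denotes the dimension of the second homology group over $\mathbb Z_2$. *)

(* Defs.v *)
From HB Require Import structures.
From mathcomp Require Import all_boot all_order all_algebra.

Set Implicit Arguments.
Unset Strict Implicit.
Unset Printing Implicit Defensive.

Import GRing.Theory.
Local Open Scope ring_scope.

Section CNF.
Variable n : nat.

(* The pair (i, true) is the literal x_i, and (i, false) its negation. *)
Definition literal := ('I_n * bool)%type.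
Definition clause := seq literal.
Definition cnf := seq clause.
Definition assignment := {ffun 'I_n -> bool}.

Definition sat_clause (x : assignment) (C : clause) : bool :=
  has (fun l : literal => x l.1 == l.2) C.

Definition sat (x : assignment) (F : cnf) : bool := all (sat_clause x) F.

Definition is_3cnf (F : cnf) : bool :=
  all (fun C : clause => (size C <= 3)%N) F.

(* An axis-aligned subcube of {0,1}^n: coordinate i is fixed to b when
   s i = Some b, and is free when s i = None. *)
Definition face := {ffun 'I_n -> option bool}.

Definition fdim (s : face) : nat := #|[set i | s i == None]|.

Definition vertex_of (x : assignment) (s : face) : bool :=
  [forall i, (s i == None) || (s i == Some (x i))].

(* t arises from s by fixing exactly one free coordinate. *)
Definition facet (t s : face) : bool :=
  [exists i, [&& s i == None, t i != None
               & [forall j, (j != i) ==> (t j == s j)]]].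

Definition in_solution_complex (F : cnf) (s : face) : bool :=
  [forall x, vertex_of x s ==> sat x F].

Lemma facetP (t s : face) :
  reflect (exists i, [/\ s i = None, t i <> None & forall j, j != i -> t j = s j])
          (facet t s).
Proof.
apply: (iffP existsP) => [[i /and3P[/eqP si /eqP ti /forallP h]]|[i [si ti h]]].
  by exists i; split=> // j ji; apply/eqP; move: (h j); rewrite ji.
exists i; apply/and3P; split; [exact/eqP | exact/eqP |].
by apply/forallP => j; apply/implyP => /h ->.
Qed.

Lemma facet_fdim (t s : face) : facet t s -> fdim s = (fdim t).+1.
Proof.
case/facetP => i [si ti h]; rewrite /fdim (cardsD1 i) inE si eqxx add1n.
congr _.+1; apply: eq_card => j; rewrite !inE.
by have [->|/h ->] := eqVneq j i; first by apply/esym/eqP.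
Qed.

Lemma facet_in_solution_complex (F : cnf) (t s : face) :
  facet t s -> in_solution_complex F s -> in_solution_complex F t.
Proof.
case/facetP => i [si ti h] /forallP Fs; apply/forallP => x; apply/implyP.
move=> /forallP xt; move: (Fs x) => /implyP; apply; apply/forallP => j.
by have [->|/h <-] := eqVneq j i; [rewrite si | exact: xt].
Qed.

End CNF.

Section Homology.
Variables (n : nat) (F : cnf n).

Definition cell (k : nat) :=
  {s : face n | (fdim s == k) && in_solution_complex F s}.

Definition chain (k : nat) := {ffun cell k -> ('F_2)^o}.

(* For k = 0 no cell of dimension k.-1 = 0 is a facet of a 0-cell, so the
   boundary out of degree 0 is the zero map. *)
Definition boundary_fun (k : nat) (c : chain k) : chain k.-1 :=
  [ffun t => \sum_(s : cell k | facet (val t) (val s)) c s].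

Lemma boundary_fun_is_linear k : linear (@boundary_fun k).
Proof.
move=> a c d; apply/ffunP => t; rewrite !ffunE scaler_sumr -big_split /=.
by apply: eq_bigr => s _; rewrite !ffunE.
Qed.

HB.instance Definition _ (k : nat) :=
  GRing.isLinear.Build 'F_2 (chain k) (chain k.-1) _ (@boundary_fun k)
    (@boundary_fun_is_linear k).

Definition boundary (k : nat) : 'Hom(chain k, chain k.-1) :=
  linfun (@boundary_fun k).

Definition cycles (k : nat) : {vspace chain k} := lker (boundary k).

Definition boundaries (k : nat) : {vspace chain k} := limg (boundary k.+1).

Lemma boundary_boundary k : (boundary k \o boundary k.+1 = 0)%VF.
Proof.
apply/lfunP => c; rewrite comp_lfunE !lfunE /=; apply/ffunP => t; rewrite !ffunE.
under eq_bigr do rewrite ffunE.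
rewrite (exchange_big_dep xpredT) //= big1 // => u _; rewrite sumr_const.
case: (pickP (fun s : cell k => facet (val t) (val s) && facet (val s) (val u)));
  last by move=> h; rewrite (eq_card (B := pred0)) ?card0 ?mulr0n.
move=> s0 /andP[ts0 s0u].
have /facetP[i [ui s0i hi]] := s0u; have /facetP[j [s0j tj hj]] := ts0.
have ij : j != i by apply: contra_notN s0i => /eqP <-.
have uj : val u j = None by rewrite -(hi j ij).
have ti : val t i = val s0 i by rewrite hj // eq_sym.
have ht l : l != i -> l != j -> val t l = val u l by move=> li lj; rewrite hj // hi.
pose s1 : face n := [ffun l => if l == j then val t j else val u l].
have s1i : s1 i = None by rewrite ffunE eq_sym (negPf ij).
have ts1 : facet (val t) s1.
  apply/facetP; exists i; split=> // [|l li]; first by rewrite ti.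
  by rewrite ffunE; have [->//|lj] := eqVneq l j; rewrite ht.
have s1u : facet s1 (val u).
  apply/facetP; exists j; split=> // [|l lj]; first by rewrite ffunE eqxx.
  by rewrite ffunE (negPf lj).
have s1P : (fdim s1 == k) && in_solution_complex F s1.
  have /andP[/eqP du Fu] := valP u.
  rewrite (facet_in_solution_complex s1u Fu) andbT.
  by rewrite -eqSS -(facet_fdim s1u) du.
pose s1' : cell k := Sub s1 s1P.
rewrite (eq_card (B := pred2 s0 s1')); last first.
  move=> s; rewrite !inE; apply/andP/idP => [[ts su]|/orP[]/eqP-> //].
  have /facetP[a [ua sa ha]] := su; have /facetP[b [sb tb hb]] := ts.
  have ab : b != a by apply: contra_notN sa => /eqP <-.
  have ub : val u b = None by rewrite -(ha b ab).
  have tsa : val t a = val s a by rewrite hb // eq_sym.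
  have in_ij l : val u l = None -> val t l <> None -> (l == i) || (l == j).
    by move=> ul tl; apply: contra_notT tl; rewrite negb_or => /andP[li lj]; rewrite ht.
  have /orP[/eqP ai|/eqP aj] : (a == i) || (a == j) by apply: in_ij; rewrite ?tsa.
    apply/orP; left; apply/eqP/val_inj/ffunP => l.
    have [->|li] := eqVneq l i; first by rewrite -ti -{1}ai -tsa ai.
    by rewrite ha ?ai // hi.
  apply/orP; right; apply/eqP/val_inj/ffunP => l; rewrite /= ffunE.
  have [->|lj] := eqVneq l j; first by rewrite -{1}aj -tsa aj.
  by rewrite ha ?aj.
have ns01 : s0 != s1' by apply: contra_notN s0i => /eqP ->.
rewrite card2 ns01.
by rewrite -mulr_natl pchar_Zp // mul0r.
Qed.

Lemma boundaries_sub_cycles k : (boundaries k <= cycles k)%VS.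
Proof.
apply/subvP => c /memv_imgP[d _ ->]; rewrite memv_ker.
by have /lfunP/(_ d) := boundary_boundary k; rewrite comp_lfunE zero_lfunE => ->.
Qed.

(* dim (cycles / boundaries); the subtraction is not truncated, by
   boundaries_sub_cycles. *)
Definition betti (k : nat) : nat := (\dim (cycles k) - \dim (boundaries k))%N.

End Homology.

(* Main.v *)
From HB Require Import structures.
Require Import Defs.
From mathcomp Require Import all_boot all_order all_algebra.
From mathcomp Require Import reals exp.
From mathcomp Require Import zify.

(** The clauses [x \/ y \/ z] and [~x \/ ~y \/ ~z] cut out of the 3-cube a
    hexagonal circle, and [y = y'] cuts out of the square two isolated points.
    Solution complexes of formulas on disjoint variables multiply, so two
    hexagons and [N] equalities give [2 ^ N] disjoint tori using only [2N + 6]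
    variables.  There are no 3-cells, and the fundamental classes of the tori
    are independent 2-cycles. *)

Set Implicit Arguments.
Unset Strict Implicit.
Unset Printing Implicit Defensive.

Import Order.TTheory GRing.Theory Num.Theory.
Local Open Scope ring_scope.

Lemma all_flatten_map (S T : Type) (p : pred T) (f : S -> seq T) (r : seq S) :
  all p (flatten [seq f x | x <- r]) = all (fun x => all p (f x)) r.
Proof. by elim: r => //= x r IHr; rewrite all_cat IHr. Qed.

(** * Faces of a solution complex in terms of clauses *)

Section FaceSatisfaction.
Variable n : nat.
Implicit Types (s t : face n) (C : clause n) (F : cnf n).

Definition face_sat_clause s C : bool :=
  has (fun l : literal n => s l.1 == Some l.2) C.

Definition nontautological C : bool :=
  [forall i, ~~ (((i, true) \in C) && ((i, false) \in C))].

(** If no literal of [C] is fixed to true on [s], some vertex of [s] falsifies [C]: since [C] never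
    contains both literals of a variable, the falsifying values do not conflict. *)
Lemma in_solution_complexE F s :
  all nontautological F -> in_solution_complex F s = all (face_sat_clause s) F.
Proof.
move=> /allP ntF; apply/forallP/allP => [sF C CF | sF x].
  (* Each free variable is given the value falsifying its literal in [C]. *)
  pose x : assignment n := [ffun i => odflt ((i, false) \in C) (s i)].
  have xs : vertex_of x s.
    by apply/forallP => i; rewrite ffunE; case: (s i) => //= b; rewrite eqxx.
  have := sF x; rewrite xs => /allP/(_ C CF)/hasP[[i b] lC /=].
  rewrite ffunE => xib; apply/hasP; exists (i, b) => //=.
  have := forallP (ntF C CF) i; case: (s i) xib => //= /eqP.
  by case: b lC => lC; [move=> ->; rewrite lC | rewrite lC].
apply/implyP => /forallP xs; apply/allP => C /sF /hasP[l lC /eqP sl].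
by apply/hasP; exists l => //; have := xs l.1; rewrite sl /= => /eqP[->].
Qed.

Definition free_at t (i : 'I_n) : face n := [ffun j => if j == i then None else t j].

Lemma facet_free_at t s :
  facet t s <-> exists2 i, t i != None & s = free_at t i.
Proof.
split=> [/facetP[i [si ti st]] | [i ti ->]].
  exists i; first exact/eqP.
  by apply/ffunP => j; rewrite ffunE; case: eqVneq => [->|/st].
apply/facetP; exists i; split; [by rewrite ffunE eqxx | exact/eqP |].
by move=> j ji; rewrite ffunE (negPf ji).
Qed.

(** Distinct fixed coordinates, once freed, give distinct cofacets. Counting coordinates instead of
    cells makes the count computable. *)
Lemma card_cofacets F k (t : cell F k) :
  #|[pred s : cell F k.+1 | facet (val t) (val s)]| =
  #|[pred i | (val t i != None) && in_solution_complex F (free_at (val t) i)]|.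
Proof.
have free_inj : {in [pred i | val t i != None] &, injective (free_at (val t))}.
  move=> i j ti _ /ffunP/(_ i); rewrite !ffunE eqxx; case: eqVneq => // _ ti'.
  by move: ti; rewrite inE -ti'.
rewrite -(card_imset _ val_inj).
rewrite -(card_in_imset (f := free_at (val t))) => [|i j /andP[ti _] /andP[tj _]];
  last exact: free_inj.
apply: eq_card => s; apply/imsetP/imsetP => [[u tu ->]|[i /andP[ti Fi] ->]].
  have /facet_free_at[i ti ui] := tu; exists i => //.
  by rewrite inE ti -ui; have /andP[] := valP u.
have ft : facet (val t) (free_at (val t) i) by apply/facet_free_at; exists i.
have uP : (fdim (free_at (val t) i) == k.+1) && in_solution_complex F (free_at (val t) i).
  by rewrite (facet_fdim ft) eqSS Fi andbT; have /andP[] := valP t.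
by exists (Sub (free_at (val t) i) uP : cell F k.+1).
Qed.

End FaceSatisfaction.

(** * The formula and the faces of its complex *)

Section Tori.
Variable N : nat.

Definition nvars : nat := (6 + (N + N))%N.

Definition hexvar (j : 'I_6) : 'I_nvars := lshift (N + N) j.
Definition eqvarl (i : 'I_N) : 'I_nvars := rshift 6 (lshift N i).
Definition eqvarr (i : 'I_N) : 'I_nvars := rshift 6 (rshift N i).

Definition nae_clauses (x y z : 'I_nvars) : cnf nvars :=
  [:: [:: (x, true); (y, true); (z, true)]; [:: (x, false); (y, false); (z, false)]].

Definition eq_clauses (x y : 'I_nvars) : cnf nvars :=
  [:: [:: (x, true); (y, false)]; [:: (x, false); (y, true)]].

Notation h k := (hexvar (@Ordinal 6 k isT)).

Definition tori_cnf : cnf nvars :=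
  nae_clauses (h 0) (h 1) (h 2) ++ nae_clauses (h 3) (h 4) (h 5) ++
  flatten [seq eq_clauses (eqvarl i) (eqvarr i) | i <- enum 'I_N].

Lemma tori_cnf_is_3cnf : is_3cnf tori_cnf.
Proof. by rewrite /is_3cnf /= all_flatten_map; apply/allP. Qed.

Lemma tori_cnf_nontautological : all (@nontautological nvars) tori_cnf.
Proof.
have nae x y z : all (@nontautological nvars) (nae_clauses x y z).
  by apply/and3P; split=> //; apply/forallP => i; rewrite !inE !xpair_eqE !andbF.
rewrite !all_cat !nae /= all_flatten_map; apply/allP => i _ /=.
have lr : eqvarl i != eqvarr i by rewrite eq_rshift eq_lrshift.
apply/and3P; split=> //; apply/forallP => j; rewrite !inE !xpair_eqE !andbF /= !andbT ?orbF;
  by apply/negP => /andP[/eqP-> /eqP e]; rewrite e eqxx in lr.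
Qed.

(** The faces of the 3-cube that avoid both constant vertices: the six vertices and six edges of the
    hexagon. *)
Definition face_nae (a b c : option bool) : bool :=
  (Some true \in [:: a; b; c]) && (Some false \in [:: a; b; c]).

Definition face_eq (a b : option bool) : bool := (a == b) && (a != None).

Lemma tori_faceE (s : face nvars) :
  in_solution_complex tori_cnf s =
  [&& face_nae (s (h 0)) (s (h 1)) (s (h 2)), face_nae (s (h 3)) (s (h 4)) (s (h 5))
    & [forall i, face_eq (s (eqvarl i)) (s (eqvarr i))]].
Proof.
have nae x y z : all (face_sat_clause s) (nae_clauses x y z) = face_nae (s x) (s y) (s z).
  rewrite /face_nae /= /face_sat_clause /= !inE.
  by case: (s x) (s y) (s z) => [[]|] [[]|] [[]|].
rewrite in_solution_complexE ?tori_cnf_nontautological // !all_cat !nae.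
congr [&& _, _ & _]; rewrite all_flatten_map.
have eqsE i : all (face_sat_clause s) (eq_clauses (eqvarl i) (eqvarr i)) =
             face_eq (s (eqvarl i)) (s (eqvarr i)).
  rewrite /= /face_sat_clause /face_eq /=.
  by case: (s (eqvarl i)) (s (eqvarr i)) => [[]|] [[]|].
apply/allP/forallP => [H i | H i _]; last exact: etrans (eqsE i) (H i).
by rewrite -eqsE; apply: H; rewrite mem_enum.
Qed.

(** An equality holds on a whole face only if both its variables are fixed, so free coordinates
    occur only among the six hexagon variables. *)
Lemma tori_eqvar (s : face nvars) (j : 'I_(N + N)) :
  in_solution_complex tori_cnf s -> s (rshift 6 j) != None.
Proof.
rewrite tori_faceE => /and3P[_ _ /forallP eqs].
by rewrite -[j]splitK; case: (split j) => i /=; have /andP[/eqP e] := eqs i;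
  rewrite /eqvarl /eqvarr in e *; rewrite ?e // -e.
Qed.

Lemma card_hexvars (P : pred 'I_nvars) :
  (forall j, ~~ P (rshift 6 j)) ->
  #|P| = (P (h 0) + P (h 1) + P (h 2) + P (h 3) + P (h 4) + P (h 5))%N.
Proof.
move=> P0; rewrite -sum1_card big_mkcond (eq_bigr (fun i => nat_of_bool (P i))) => [|i _];
  last by rewrite unfold_in; case: (P i).
rewrite big_split_ord /= [X in (_ + X)%N]big1 => [|j _]; last by rewrite (negPf (P0 j)).
rewrite addn0 !big_ord_recl big_ord0 addn0 !addnA.
by congr (_ + _ + _ + _ + _ + _)%N; congr (nat_of_bool (P _)); apply: val_inj.
Qed.

Lemma tori_fdim (s : face nvars) : in_solution_complex tori_cnf s ->
  fdim s = ((s (h 0) == None) + (s (h 1) == None) + (s (h 2) == None) +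
            (s (h 3) == None) + (s (h 4) == None) + (s (h 5) == None))%N.
Proof.
move=> sF; rewrite /fdim cardsE (@card_hexvars (fun i => s i == None)) // => j.
exact: tori_eqvar.
Qed.

(** Each hexagon contributes at most one free coordinate. *)
Lemma tori_dim_le2 (s : face nvars) : in_solution_complex tori_cnf s -> (fdim s <= 2)%N.
Proof.
move=> sF; rewrite (tori_fdim sF); move: sF; rewrite tori_faceE => /and3P[+ + _].
case: (s (h 0)) (s (h 1)) (s (h 2)) => [[]|] [[]|] [[]|] //= _;
by case: (s (h 3)) (s (h 4)) (s (h 5)) => [[]|] [[]|] [[]|].
Qed.

(** An edge of a torus is an edge of one hexagon times a vertex of the other. That vertex lies on
    exactly two hexagon edges, so the edge lies in exactly two squares. *)
Lemma tori_cofacets_even (t : cell tori_cnf 1) :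
  ~~ odd #|[pred s : cell tori_cnf 2 | facet (val t) (val s)]|.
Proof.
have /andP[/eqP dt tF] := valP t; rewrite card_cofacets card_hexvars => [|j]; last first.
  (* Freeing an equality variable leaves the complex. *)
  rewrite !inE negb_and orbC; apply/orP; left; apply/negP => /(tori_eqvar j).
  by rewrite ffunE eqxx.
move: dt; rewrite (tori_fdim tF) /=.
move: (tF); rewrite !tori_faceE => /and3P[nae1 nae2 /forallP eqs].
have eqs' k : [forall i, face_eq (free_at (val t) (hexvar k) (eqvarl i))
                                 (free_at (val t) (hexvar k) (eqvarr i))].
  by apply/forallP => i; rewrite !ffunE !eq_rlshift.
rewrite !eqs' !andbT !ffunE !(inj_eq (@lshift_inj _ _)) !eqE /=.
move: nae1 nae2.
case: (val t (h 0)) (val t (h 1)) (val t (h 2)) => [[]|] [[]|] [[]|] //= _;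
by case: (val t (h 3)) (val t (h 4)) (val t (h 5)) => [[]|] [[]|] [[]|].
Qed.

(** * The tori and their fundamental classes *)

Definition component (s : face nvars) : {ffun 'I_N -> bool} :=
  [ffun i => s (eqvarl i) == Some true].

Lemma component_facet (s t : face nvars) : in_solution_complex tori_cnf s ->
  facet t s -> component s = component t.
Proof.
move=> sF /facetP[i [si _ st]]; apply/ffunP => j; rewrite !ffunE st //.
by apply: contraTneq (tori_eqvar (lshift N j) sF) => e; rewrite -[rshift _ _]/(eqvarl j) e si.
Qed.

(** A sample square on the torus indexed by [a]: the same edge is taken in both hexagons. *)
Definition component_square (a : {ffun 'I_N -> bool}) : face nvars :=
  [ffun k => match split k with
             | inl j => nth None [:: None; Some true; Some false;
                                     None; Some true; Some false] j
             | inr j => Some (match split j with inl i | inr i => a i end)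
             end].

Lemma component_squareP a :
  [/\ in_solution_complex tori_cnf (component_square a), fdim (component_square a) = 2%N
    & component (component_square a) = a].
Proof.
have sh j : split (hexvar j) = inl j by exact: (unsplitK (inl j)).
have sl i : split (eqvarl i) = inr (lshift N i) by exact: (unsplitK (inr (lshift N i))).
have sr i : split (eqvarr i) = inr (rshift N i) by exact: (unsplitK (inr (rshift N i))).
have sl' (i : 'I_N) : split (lshift N i) = inl i by exact: (unsplitK (inl i)).
have sr' (i : 'I_N) : split (rshift N i) = inr i by exact: (unsplitK (inr i)).
have aF : in_solution_complex tori_cnf (component_square a).
  rewrite tori_faceE !ffunE !sh /=; apply/forallP => i.
  by rewrite !ffunE sl sr sl' sr' /face_eq eqxx.
split=> //; first by rewrite (tori_fdim aF) !ffunE !sh.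
by apply/ffunP => i; rewrite !ffunE sl sl'; case: (a i).
Qed.

(** The combination of the fundamental classes of the tori with coefficients [f a]. *)
Definition tori_class (f : {ffun {ffun 'I_N -> bool} -> ('F_2)^o}) : chain tori_cnf 2 :=
  [ffun s => f (component (val s))].

Lemma tori_class_is_linear : linear tori_class.
Proof. by move=> k f g; apply/ffunP => s; rewrite !ffunE. Qed.

HB.instance Definition _ :=
  GRing.isLinear.Build 'F_2 {ffun {ffun 'I_N -> bool} -> ('F_2)^o} (chain tori_cnf 2)
    _ tori_class tori_class_is_linear.

(** The coefficient [f a] is read off at [component_square a]. *)
Lemma tori_class_inj : injective tori_class.
Proof.
move=> f g /ffunP fg; apply/ffunP => a.
have [aF da ca] := component_squareP a.
have sP : (fdim (component_square a) == 2%N) && in_solution_complex tori_cnf (component_square a).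
  by rewrite da aF.
by have := fg (Sub (component_square a) sP : cell tori_cnf 2); rewrite !ffunE /= ca.
Qed.

(** All squares around an edge lie on its torus and carry the same coefficient; their number is
    even, so the sum vanishes in characteristic 2. *)
Lemma tori_class_cycle f : tori_class f \in cycles tori_cnf 2.
Proof.
rewrite memv_ker lfunE /=; apply/eqP/ffunP => t; rewrite !ffunE.
rewrite (eq_bigr (fun=> f (component (val t)))) => [|s ts]; last first.
  by rewrite ffunE (component_facet _ ts) //; have /andP[] := valP s.
rewrite sumr_const -(odd_double_half #|_|) (negPf (tori_cofacets_even t)).
by rewrite add0n -mul2n mulrnA -[_ *+ 2]mulr_natl pchar_Zp // mul0r mul0rn.
Qed.

Lemma betti2_tori : (2 ^ N <= betti tori_cnf 2)%N.
Proof.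
have -> : betti tori_cnf 2 = \dim (cycles tori_cnf 2).
  rewrite /betti (_ : boundaries _ _ = 0%VS) ?dimv0 ?subn0 //.
  apply/eqP; rewrite -subv0; apply/subvP => c /memv_imgP[d _ ->].
  (* There are no 3-cells, so every 3-chain is zero. *)
  rewrite (_ : d = 0) ?linear0 ?mem0v //; apply/ffunP => s.
  by have /andP[/eqP ds /tori_dim_le2] := valP s; rewrite ds.
have kerT : lker (linfun tori_class) == 0%VS.
  by apply/lker0P => f g; rewrite !lfunE; apply: tori_class_inj.
have <- : \dim (limg (linfun tori_class)) = (2 ^ N)%N.
  rewrite limg_dim_eq ?(eqP kerT) ?capv0 // dimvf /dim /= muln1.
  by rewrite card_ffun card_bool card_ord.
apply/dimvS/subvP => c /memv_imgP[f _ ->]; rewrite lfunE; exact: tori_class_cycle.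
Qed.

End Tori.

Theorem mainTheorem6 (R : realType) :
  exists (n : nat -> nat) (F : forall N : nat, cnf (n N)),
    [/\ forall N : nat, is_3cnf (F N),
        exists (C : R) (N0 : nat), 0 < C /\
          forall N : nat, (N0 <= N)%N ->
            (n N)%:R <= C * (N%:R ^+ 2 / ln (N%:R : R))
      & exists (c : R) (N0 : nat), 0 < c /\
          forall N : nat, (N0 <= N)%N ->
            2%:R `^ (c * N%:R) <= (betti (F N) 2)%:R].
Proof.
exists nvars, tori_cnf; split; first exact: tori_cnf_is_3cnf.
  (* From [N = 2] on, [6 + 2N <= 5N] and [ln N] is positive. *)
  exists 5%:R, 2%N; split=> [|N N2]; first by rewrite ltr0n.
  have N0 : 0 < N%:R :> R by rewrite ltr0n (leq_trans _ N2).
  have lnN : 0 < ln (N%:R : R) by rewrite ln_gt0 // ltr1n.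
  apply: (@le_trans _ _ (5%:R * N%:R)).
    by rewrite -natrM ler_nat /nvars addnn -muln2; lia.
  (* The linear bound suffices, since [ln N < N] gives [N <= N^2 / ln N]. *)
  rewrite ler_pM2l ?ltr0n // ler_pdivlMr // expr2 ler_pM2l //.
  exact/ltW/ln_sublinear.
exists 1, 0%N; split=> // N _.
by rewrite mul1r powR_mulrn // -natrX ler_nat betti2_tori.
Qed.
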